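(* For all sufficiently large $n$ of the form $n=2^k-1$ with $k$ an integer, there exist a monotone function $g:\{0,1\}^n\to\{0,1\}$ and a pairwise independent distribution $D'$ over $\{0,1\}^n$ such that $g$ is balanced with respect to $D'$ and $$I_i(g,D')=0\quad\text{for all } i\in\{1,\ldots,n\}.$$
   Context: A distribution $D'$ on $\{0,1\}^n$ is pairwise independent if, for $X=(X_1,\ldots,X_n)$ drawn from $D'$, the variables $X_i,X_j$ are independent for all $i\neq j$. A function $g:\{0,1\}^n\to\{0,1\}$ is monotone if $g(x)\le g(y)$ whenever $x\le y$ coordinatewise. $g$ is balanced with respect to $D'$ if $\mathbb{E}_{X\sim D'}[g(X)]=1/2$. The influence of the $i$'th player in $g$ with respect to a distribution $\mu$ on $\{0,1\}^n$ is $$I_i(g,\mu)=\Pr_{x\sim\mu}\big[g(x)\neq g(x\oplus e_i)\big],$$ where $e_i$ is the vector with $1$ at the $i$'th index and $0$ elsewhere, and $\oplus$ is bitwise XOR (the point $x\oplus e_i$ need not be in the support of $\mu$). *)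

(* Defs.v *)
From HB Require Import structures.
From mathcomp Require Import all_boot all_order all_algebra.
From mathcomp Require Import all_classical all_reals all_analysis.

Set Implicit Arguments.
Unset Strict Implicit.
Unset Printing Implicit Defensive.

Import Order.TTheory GRing.Theory Num.Theory.

Local Open Scope classical_set_scope.
Local Open Scope ring_scope.

(* The product sigma-algebra of [n.-tuple bool] is the full powerset, so a
   [probability (n.-tuple bool) R] is an arbitrary distribution on {0,1}^n and
   every function on the cube is a random variable. *)
Lemma measurable_cube (n : nat) (A : set (n.-tuple bool)) : measurable A.
Proof.
have m1 (x : n.-tuple bool) : measurable [set x].
  have -> : [set x] = \bigcap_(i in [set: 'I_n])
      ((fun y : n.-tuple bool => tnth y i) @^-1` [set tnth x i]).
    apply/seteqP; split=> [y /= -> //|y xy].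
    by apply: eq_from_tnth => i; exact: xy.
  apply: fin_bigcap_measurable => // i _; rewrite -[X in measurable X]setTI.
  exact: (@measurable_tnth _ bool n i).
by apply: countable_measurable => //; exact/finite_set_countable/finite_finset.
Qed.

Definition independent_rv (d d1 d2 : measure_display) (T : measurableType d)
    (T1 : measurableType d1) (T2 : measurableType d2) (R : realType)
    (P : probability T R) (X : T -> T1) (Y : T -> T2) : Prop :=
  forall (A : set T1) (B : set T2), measurable A -> measurable B ->
    P (X @^-1` A `&` Y @^-1` B) = (P (X @^-1` A) * P (Y @^-1` B))%E.

Definition pairwise_independent (R : realType) (n : nat)
    (D : probability (n.-tuple bool) R) : Prop :=
  forall i j : 'I_n, i != j ->
    independent_rv D (fun x : n.-tuple bool => tnth x i)
                     (fun x : n.-tuple bool => tnth x j).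

Definition cube_monotone (n : nat) (g : n.-tuple bool -> bool) : Prop :=
  forall x y : n.-tuple bool,
    (forall i : 'I_n, (tnth x i <= tnth y i)%O) -> (g x <= g y)%O.

Definition balanced (R : realType) (n : nat) (g : n.-tuple bool -> bool)
    (D : probability (n.-tuple bool) R) : Prop :=
  ('E_D[fun x => (g x)%:R])%E = (2^-1)%:E.

(* x (+) e_i *)
Definition flip (n : nat) (x : n.-tuple bool) (i : 'I_n) : n.-tuple bool :=
  [tuple tnth x j (+) (j == i) | j < n].

Definition influence (R : realType) (n : nat) (i : 'I_n)
    (g : n.-tuple bool -> bool) (D : probability (n.-tuple bool) R) : \bar R :=
  D [set x | g x != g (flip x i)].

(* Main.v *)
Require Import Defs.
From mathcomp Require Import all_boot all_order all_algebra.
From mathcomp Require Import all_classical all_reals all_analysis.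
From mathcomp Require Import zify ring.

(** The distribution is uniform on the simplex code: for a uniform over F_2^k,
the word of a lists the scalar products <v, a> over all nonzero v in F_2^k, so
there are n = 2^k - 1 players.  Two distinct nonzero v, w are linearly
independent over F_2, hence (<v, a>, <w, a>) is uniform on {0,1}^2 and the
players are pairwise independent ([dot_independent]).

Moreover no nonzero codeword is close to lying below another codeword: if a is
nonzero and b differs from a, then the word of a has at least 2^k / 4 ones at places where the
word of b has zeros ([simplex_excess]).  Fix one player p and let S be the set of
the codewords with a one at p.  The function g is true at z when some word of S
exceeds z in at most one coordinate.  It is monotone.  On a word of S it is
true, and stays true after one flip.  A codeword outside S is exceeded by every
word of S in at least 4 coordinates as soon as k >= 4 (words of S come from
nonzero vectors), so g is false there and stays false after one flip.  Thus no
player has influence on the code, and on the code g is just the coordinate p,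
which is true with probability 1/2.

Both counting facts follow from one translation argument, [sum_dot2]. *)

Set Implicit Arguments.
Unset Strict Implicit.
Unset Printing Implicit Defensive.

Import Order.TTheory GRing.Theory Num.Theory.

Local Open Scope classical_set_scope.
Local Open Scope ring_scope.

(** The booleans carry the field structure of F_2: sum is exclusive or, product is
conjunction. *)
Definition dot (k : nat) (u w : 'rV[bool]_k) : bool := (u *m w^T) 0 0.

Lemma dotC (k : nat) (u w : 'rV[bool]_k) : dot u w = dot w u.
Proof. by rewrite /dot !mxE; apply: eq_bigr => i _; rewrite !mxE mulrC. Qed.

Lemma dotDr (k : nat) (u w t : 'rV[bool]_k) :
  dot u (w + t) = dot u w (+) dot u t.
Proof. by rewrite /dot linearD/= mulmxDr mxE. Qed.

Lemma dot0 (k : nat) (u : 'rV[bool]_k) : dot u 0 = false.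
Proof. by rewrite /dot trmx0 mulmx0 mxE. Qed.

Lemma dot_delta (k : nat) (u : 'rV[bool]_k) (i : 'I_k) :
  dot u (delta_mx 0 i) = u 0 i.
Proof. by rewrite /dot trmx_delta -colE mxE. Qed.

(** Over F_2 the hypotheses say that w is 0 or linearly independent of u, so
some t has scalar product 1 with u and 0 with w; a basis vector or the sum of
two basis vectors is enough. *)
Lemma dot_separate (k : nat) (u w : 'rV[bool]_k) : u != 0 -> u != w ->
  exists t, dot u t /\ dot w t = false.
Proof.
move=> u0 uw.
have [i uwi] : exists i, u 0 i != w 0 i.
  apply/existsP; rewrite -negb_forall; apply: contra uw => /forallP uw.
  by apply/eqP/rowP => i; exact/eqP.
have [j uj] : exists j, u 0 j.
  apply/existsP; rewrite -[X in is_true X]negbK negb_exists.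
  apply: contra u0 => /forallP u0.
  by apply/eqP/rowP => i'; rewrite mxE; apply/negbTE.
(* If u and w differ at i because w is 1 there, either the basis vector at a
one of u works, or adding the basis vector at i repairs the product with w. *)
case ui : (u 0 i) uwi => wi.
  by exists (delta_mx 0 i); rewrite !dot_delta ui; case: (w 0 i) wi.
case wj : (w 0 j); last by exists (delta_mx 0 j); rewrite !dot_delta uj wj.
exists (delta_mx 0 i + delta_mx 0 j); rewrite !dotDr !dot_delta ui uj wj.
by case: (w 0 i) wi.
Qed.

(** Translation by the vector of [dot_separate] flips the product with u and
keeps the one with w, so the first argument of F can be averaged out. *)
Lemma sum_dot2 (k : nat) (u w : 'rV[bool]_k) (F : bool -> bool -> nat) :
  u != 0 -> u != w ->
  ((\sum_a F (dot u a) (dot w a)) * 2 =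
   \sum_a (F true (dot w a) + F false (dot w a)))%N.
Proof.
move=> u0 uw; have [t [ut wt]] := dot_separate u0 uw.
rewrite muln2 -addnn {1}(reindex_inj (addIr t)) /= -big_split /=.
apply: eq_bigr => a _; rewrite !dotDr ut wt addbT addbF.
by case: (dot u a) => //=; rewrite addnC.
Qed.

Lemma sum_dot1 (k : nat) (u : 'rV[bool]_k) (f : bool -> nat) : u != 0 ->
  ((\sum_a f (dot u a)) * 2 = 2 ^ k * (f true + f false))%N.
Proof.
move=> u0; rewrite (sum_dot2 (fun b _ => f b) u0 u0) sum_nat_const.
by rewrite card_mx card_bool mul1n.
Qed.

(** Independence of two distinct nonzero linear forms, as a count multiplied out
by the square of the number of vectors: 2^k is that number. *)
Lemma dot_independent (k : nat) (u w : 'rV[bool]_k) (f g : bool -> nat) :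
  u != 0 -> w != 0 -> u != w ->
  ((\sum_a f (dot u a) * g (dot w a)) * 2 ^ k =
   (\sum_a f (dot u a)) * (\sum_a g (dot w a)))%N.
Proof.
move=> u0 w0 uw.
have fg := sum_dot2 (fun b c => f b * g c)%N u0 uw.
have f1 := sum_dot1 f u0.
move: fg; under [RHS]eq_bigr do rewrite -mulnDl.
rewrite -big_distrr /= => fg.
apply/eqP; rewrite -(eqn_pmul2r (_ : 0 < 2)%N)//; apply/eqP.
by rewrite mulnAC fg [RHS]mulnAC f1; ring.
Qed.

(** The sum is exactly a quarter of 2^k when b is nonzero, a half when b = 0. *)
Lemma dot_excess (k : nat) (a b : 'rV[bool]_k) : a != 0 -> a != b ->
  (2 ^ k <= 4 * \sum_w (dot a w && ~~ dot b w))%N.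
Proof.
move=> a0 ab.
have := sum_dot2 (fun x y => x && ~~ y : nat) a0 ab => /=.
under [in RHS]eq_bigr do rewrite addn0.
have [->|b0] := eqVneq b 0.
  under [in RHS]eq_bigr do rewrite dotC dot0.
  rewrite sum_nat_const card_mx card_bool mul1n; lia.
have := sum_dot1 (fun y => ~~ y : nat) b0 => /=; lia.
Qed.

Definition excess (n : nat) (x y : n.-tuple bool) : nat :=
  \sum_(i < n) (tnth x i && ~~ tnth y i).

Lemma excess_xx (n : nat) (x : n.-tuple bool) : excess x x = 0%N.
Proof. by rewrite /excess big1// => i _; rewrite andbN. Qed.

Lemma excess_flip (n : nat) (x y : n.-tuple bool) (i : 'I_n) :
  (excess x (flip y i) <= (excess x y).+1)%N.
Proof.
rewrite /excess (bigD1 i)//= (bigD1 i (P := xpredT))//=.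
rewrite (eq_bigr (fun j => (tnth x j && ~~ tnth y j) : nat)); last first.
  by move=> j ji; rewrite tnth_mktuple (negbTE ji) addbF.
by rewrite -addSn leq_add2r; case: (_ && _).
Qed.

Lemma flipK (n : nat) (i : 'I_n) : involutive (fun x : n.-tuple bool => flip x i).
Proof. by move=> x; apply: eq_from_tnth => j; rewrite !tnth_mktuple addbK. Qed.

Section thickened_upset.
Context (n : nat) (S : pred (n.-tuple bool)).

(** The upward closure of the points obtained from S by lowering at most one
coordinate: the smallest monotone function that is true on S and on all
neighbours of S. *)
Definition near_above (z : n.-tuple bool) : bool :=
  [exists x, S x && (excess x z <= 1)%N].

Lemma near_above_monotone : cube_monotone near_above.
Proof.
move=> y z yz.
suff mono : near_above y -> near_above z.
  by case: (near_above y) mono => [->|].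
move=> /existsP[x /andP[Sx xy]]; apply/existsP; exists x.
rewrite Sx; apply: leq_trans xy; apply: leq_sum => i _.
by have := yz i; case: (tnth x i) (tnth y i) (tnth z i) => [] [] [].
Qed.

Lemma near_above_in (z : n.-tuple bool) : S z -> near_above z.
Proof. by move=> Sz; apply/existsP; exists z; rewrite Sz excess_xx. Qed.

Lemma near_above_flip_in (z : n.-tuple bool) (i : 'I_n) :
  S z -> near_above (flip z i).
Proof.
move=> Sz; apply/existsP; exists z; rewrite Sz /=.
by rewrite (leq_trans (excess_flip _ _ _))// excess_xx.
Qed.

(** A point at excess at least 2 from S lies outside the upset, and one flip
lowers the excess by at most 1; excess at least 3 covers both this lemma and the
next one. *)
Lemma near_above_far (z : n.-tuple bool) :
  (forall x, S x -> (2 < excess x z)%N) -> ~~ near_above z.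
Proof.
move=> far; apply/existsP => -[x /andP[Sx]]; have := far _ Sx; lia.
Qed.

Lemma near_above_flip_far (z : n.-tuple bool) (i : 'I_n) :
  (forall x, S x -> (2 < excess x z)%N) -> ~~ near_above (flip z i).
Proof.
move=> far; apply/existsP => -[x /andP[Sx]]; have := far _ Sx.
have := excess_flip x (flip z i) i; rewrite flipK; lia.
Qed.

End thickened_upset.

Lemma in_set_pred (T : Type) (P : pred T) (x : T) :
  (x \in [set y | P y]) = P x.
Proof. by apply/idP/idP; rewrite inE. Qed.

(** The uniform distribution on T transported by f, obtained by normalizing a
finite sum of Dirac masses. *)
Lemma uniform_law (R : realType) (d : measure_display) (X : measurableType d)
    (T : finType) (t0 : T) (f : T -> X) :
  exists P : probability X R,
    forall A, P A = ((\sum_t (f t \in A))%N%:R / #|T|%:R)%:E.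
Proof.
have [mu muE] : exists mu : {measure set X -> \bar R},
    forall A, mu A = (\sum_t (f t \in A))%N%:R%:E.
  exists (msum (fun j => dirac (f (nth t0 (enum T) j))) #|T|) => A.
  rewrite /= /msum /= sumEFin -natr_sum; congr (_%:R%:E).
  rewrite cardE -(big_mkord xpredT (fun j => f (nth t0 (enum T) j) \in A : nat)).
  by rewrite -(big_nth t0 xpredT (fun t => f t \in A : nat)) big_enum.
have muT : mu setT = #|T|%:R%:E.
  by rewrite muE; under eq_bigr do rewrite in_setT; rewrite sum1_card.
have T0 : (0 < #|T|)%N by apply/card_gt0P; exists t0.
exists (mnormalize mu (dirac (f t0))) => A.
rewrite /= /mnormalize muT eqe pnatr_eq0 gtn_eqF//=.
by rewrite muE.
Qed.

Section simplex_code.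
Context (k : nat).

Definition nonzero := [pred w : 'rV[bool]_k | w != 0].

Lemma card_nonzero : #|nonzero| = (2 ^ k - 1)%N.
Proof.
have := cardC1 (0 : 'rV[bool]_k).
by rewrite card_mx card_bool mul1n subn1 => <-; apply: eq_card => w; rewrite !inE.
Qed.

Definition simplex_word (a : 'rV[bool]_k) : #|nonzero|.-tuple bool :=
  [tuple dot (enum_val i) a | i < #|nonzero|].

(** Dropping the coordinate w = 0 from [dot_excess] loses nothing, since every
scalar product with 0 vanishes. *)
Lemma simplex_excess (a b : 'rV[bool]_k) : a != 0 -> a != b ->
  (2 ^ k <= 4 * excess (simplex_word a) (simplex_word b))%N.
Proof.
move=> a0 ab; rewrite (leq_trans (dot_excess a0 ab))// leq_mul2l /=.
rewrite (bigID (mem nonzero)) /= [X in (_ + X)%N]big1 ?addn0; last first.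
  by move=> w; rewrite negbK => /eqP->; rewrite dot0.
rewrite big_enum_val /excess; apply: leq_sum => i _.
by rewrite !tnth_mktuple !(dotC _ (enum_val i)).
Qed.

End simplex_code.

Theorem mainTheorem5 (R : realType) :
  exists N : nat, forall n k : nat, (N <= n)%N -> n = (2 ^ k - 1)%N ->
    exists (g : n.-tuple bool -> bool) (D' : probability (n.-tuple bool) R),
      [/\ cube_monotone g,
          pairwise_independent D',
          balanced g D' &
          forall i : 'I_n, influence i g D' = 0%E].
Proof.
(* The least n = 2^k - 1 above 8 is 15: the argument needs k >= 4. *)
exists 8%N => n k n8 nE.
have k4 : (3 < k)%N.
  by rewrite ltnNge; apply: contraL n8; rewrite nE; case: k {nE} => [|[|[|[|]]]].
have k16 : (16 <= 2 ^ k)%N by rewrite (@leq_exp2l 2 4 k).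
move: nE; rewrite -card_nonzero => nE; subst n.
have p0 : (0 < #|nonzero k|)%N by lia.
pose p : 'I_#|nonzero k| := Ordinal p0.
have v0 (i : 'I_#|nonzero k|) : enum_val i != 0 by have := enum_valP i.
have card_k : #|{: 'rV[bool]_k}| = (2 ^ k)%N by rewrite card_mx card_bool mul1n.
have pow0 : (2 ^ k)%:R != 0 :> R by rewrite pnatr_eq0; lia.
have [D DE] := uniform_law R (0 : 'rV[bool]_k) (@simplex_word k).
rewrite card_k in DE.
pose S x := [exists a, (x == simplex_word a) && tnth (simplex_word a) p].
have S_word a : tnth (simplex_word a) p -> S (simplex_word a).
  by move=> ap; apply/existsP; exists a; rewrite eqxx.
have far a : ~~ tnth (simplex_word a) p ->
    forall x, S x -> (2 < excess x (simplex_word a))%N.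
  move=> ap x /existsP[b /andP[/eqP-> bp]].
  have b0 : b != 0 by apply: contraTneq bp => ->; rewrite tnth_mktuple dot0.
  have ba : b != a by apply: contraNneq ap => <-.
  have := simplex_excess b0 ba; lia.
(* On the code, and after one flip of a codeword, the function is the
coordinate p of the codeword. *)
have gE a : near_above S (simplex_word a) = tnth (simplex_word a) p.
  have [ap|ap] := boolP (tnth _ _).
    exact/near_above_in/S_word.
  exact/negbTE/near_above_far/far.
have gfE a i : near_above S (flip (simplex_word a) i) = tnth (simplex_word a) p.
  have [ap|ap] := boolP (tnth _ _).
    exact/near_above_flip_in/S_word.
  exact/negbTE/near_above_flip_far/far.
exists (near_above S), D; split.
- exact: near_above_monotone.
- move=> i j ij A B _ _; rewrite !DE -EFinM; congr EFin.
  have uw : enum_val i != enum_val j :> 'rV[bool]_k by rewrite (inj_eq enum_val_inj).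
  have mE (C : set bool) (l : 'I_#|nonzero k|) a :
      (simplex_word a \in (fun x => tnth x l) @^-1` C) = (dot (enum_val l) a \in C).
    by rewrite -[LHS]/(tnth (simplex_word a) l \in C) tnth_mktuple.
  rewrite (eq_bigr _ (fun a _ => congr1 nat_of_bool (mE A i a))).
  rewrite (eq_bigr _ (fun a _ => congr1 nat_of_bool (mE B j a))).
  under eq_bigr do rewrite in_setI !mE -mulnb.
  have /(congr1 (fun m => m%:R : R)) := dot_independent
    (fun b => b \in A : nat) (fun b => b \in B : nat) (v0 i) (v0 j) uw.
  by rewrite !natrM => e; field: e.
- rewrite /balanced.
  have -> : (fun x => (near_above S x)%:R) = \1_[set x | near_above S x] :> (_ -> R).
    by apply/funext => x; rewrite indicE in_set_pred.
  rewrite expectation_indic; last exact: measurable_cube.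
  rewrite DE; congr EFin.
  under eq_bigr do rewrite in_set_pred gE tnth_mktuple.
  have /(congr1 (fun m => m%:R : R)) := sum_dot1 (fun b => b : nat) (v0 p).
  by rewrite addn0 muln1 natrM => e; field: e.
- move=> i; rewrite /influence DE big1 ?mul0r// => a _.
  by rewrite in_set_pred gE gfE eqxx.
Qed.
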